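(* Let $r_{\mathrm{base}}$ be a fixed non-negative continuous function on $[0,1]$ that is not identically zero on $[q_0-\varepsilon,q_0+\varepsilon]$. For a scaling parameter $C>0$, let $(\mathbf{x}_C^*,a_C^* )$ be a minimizer of $J$ over $\Delta\times I$ when the ambiguity radius is $r(q)=C\cdot r_{\mathrm{base}}(q)$. Then, as $C\to\infty$, $\mathbf{x}_C^*$ converges to the equal-weighted portfolio $\frac1d\mathbf{1}$.
   Context: $\Delta=\{\mathbf{x}\in\mathbb{R}^d:\mathbf{x}\ge 0,\ \mathbf{1}'\mathbf{x}=1\}$; $\mathbf{1}$ is the all-ones vector; $\|\cdot\|$ is the Euclidean norm; $\mathbf{R}$ is an $\mathbb{R}^d$-valued random vector; $\mathbb{E}_P$ is expectation when $\mathbf{R}\sim P$; $\mu_P,\Sigma_P$ are the mean and covariance matrix of $P$. $W_2(\mu,\nu)^2=\inf\mathbb{E}\|\mathbf{X}-\mathbf{Y}\|^2$ over couplings, and $\mathbb{B}_{W_2}(\mu,r)=\{\nu:W_2(\mu,\nu)\le r\}$. Standing data: $\gamma>0$; $P_N,P_{S_0}$ are Borel probability measures on $\mathbb{R}^d$ with finite second moments and positive definite covariance matrices; $q_0\in(0,1)$, $0<\varepsilon<\min(q_0,1-q_0)$. For a radius function $r:[0,1]\to[0,\infty)$, $$\mathcal{S}=\{(1-q)P_N+qP_S:\ q\in[q_0-\varepsilon,q_0+\varepsilon],\ P_S\in\mathbb{B}_{W_2}(P_{S_0},r(q))\}.$$ $I\subset\mathbb{R}$ is a compact interval, not depending on $\mathbf{x}$,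 containing $\mathbb{E}_P(\mathbf{x}'\mathbf{R})$ for all $\mathbf{x}\in\Delta$, $P\in\mathcal{S}$ (it is associated with the ambiguity set $\mathcal{S}$). Define $$\psi_{a,\gamma}(y)=(y-a)^2-\gamma y,\qquad S_\gamma(\mathbf{x},a)=\sqrt{\mathbf{x}'\Sigma_{P_{S_0}}\mathbf{x}+\left(\mathbf{x}'\mu_{P_{S_0}}-\tfrac{2a+\gamma}{2}\right)^2},$$ $$h(q,\mathbf{x},a)=(1-q)\mathbb{E}_{P_N}(\psi_{a,\gamma}(\mathbf{x}'\mathbf{R}))+q\left[(r(q)\|\mathbf{x}\|+S_\gamma(\mathbf{x},a))^2-a\gamma-\tfrac{\gamma^2}{4}\right],$$ $$J(\mathbf{x},a)=\sup_{q\in[q_0-\varepsilon,q_0+\varepsilon]}h(q,\mathbf{x},a).$$ *)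

(* Defs.v *)
From HB Require Import structures.
From mathcomp Require Import all_boot all_order all_algebra.
From mathcomp Require Import all_classical all_reals all_analysis.
Set Implicit Arguments.
Unset Strict Implicit.
Unset Printing Implicit Defensive.
Import Order.TTheory GRing.Theory Num.Theory.
Import numFieldNormedType.Exports.
Local Open Scope classical_set_scope.
Local Open Scope ring_scope.

(* R^d with its Borel sigma-algebra; the carrier is convertible to 'cV[R]_d. *)
Notation borelRd R d := (g_sigma_algebraType (@open 'cV[R]_d)).

Section Defs.
Context {R : realType} {d : nat}.
Implicit Types (x u v : 'cV[R]_d) (a q : R) (r : R -> R).
Implicit Types (P Q PN PS : probability (borelRd R d) R).

Definition dotp u v : R := (u^T *m v) ord0 ord0.

(* The norm that MathComp-Analysis puts on matrices is the sup norm. *)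
Definition enorm u : R := Num.sqrt (dotp u u).

Definition simplex : set 'cV[R]_d :=
  [set x : 'cV[R]_d | (forall i, 0 <= x i ord0) /\ dotp (const_mx 1) x = 1].

(* E_P(f(R)) as a real; [fine] would send a non-finite integral to 0, but f is at
   most quadratic and the measures used have finite second moments. *)
Definition Exp P (f : 'cV[R]_d -> R) : R :=
  fine ('E_P[(f : borelRd R d -> R)])%E.

Definition mean P : 'cV[R]_d := \col_i Exp P (fun w => w i ord0).

Definition cov P : 'M[R]_d :=
  \matrix_(i, j) fine (covariance P
    (fun w : borelRd R d => (w : 'cV[R]_d) i ord0)
    (fun w : borelRd R d => (w : 'cV[R]_d) j ord0)).

Definition quad (A : 'M[R]_d) u : R := dotp u (A *m u).

Definition finite_second_moment P : Prop :=
  (\int[P]_w ((enorm w) ^+ 2)%:E < +oo)%E.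

Definition posdef (A : 'M[R]_d) : Prop :=
  A^T = A /\ forall u, u != 0 -> 0 < quad A u.

Definition coupling P Q
    (pi : probability (borelRd R d * borelRd R d)%type R) : Prop :=
  forall A : set (borelRd R d), measurable A ->
    pi (fst @^-1` A) = P A /\ pi (snd @^-1` A) = Q A.

Definition W2 P Q : \bar R :=
  (ereal_inf [set (\int[pi]_z ((enorm ((z.1 : 'cV[R]_d) - z.2)) ^+ 2)%:E)%E
             | pi in coupling P Q] `^ 2^-1)%E.

Definition W2_ball P (rho : R) : set (probability (borelRd R d) R) :=
  [set Q | (W2 P Q <= rho%:E)%E].

Definition is_mixture q PN PS P : Prop :=
  forall A : set (borelRd R d), measurable A ->
    P A = ((1 - q)%:E * PN A + q%:E * PS A)%E.

Definition ambiguity_set PN PS0 q0 eps r :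
    set (probability (borelRd R d) R) :=
  [set P | exists q PS, [/\ q \in `[q0 - eps, q0 + eps],
     W2_ball PS0 (r q) PS & is_mixture q PN PS P]].

Definition psi a gamma (y : R) : R := (y - a) ^+ 2 - gamma * y.

Definition Sgam PS0 gamma x a : R :=
  Num.sqrt (quad (cov PS0) x
            + (dotp x (mean PS0) - (2 * a + gamma) / 2) ^+ 2).

Definition hfun PN PS0 gamma r q x a : R :=
  (1 - q) * Exp PN (fun w => psi a gamma (dotp x w))
  + q * ((r q * enorm x + Sgam PS0 gamma x a) ^+ 2
         - a * gamma - gamma ^+ 2 / 4).

(* For r continuous on [0,1] the set below is bounded, so that [sup] is its
   least upper bound. *)
Definition Jfun PN PS0 gamma q0 eps r x a : R :=
  sup [set hfun PN PS0 gamma r q x a | q in `[q0 - eps, q0 + eps]].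

Definition is_minimizer (f : 'cV[R]_d -> R -> R) (X : set 'cV[R]_d)
    (I : set R) x a : Prop :=
  [/\ X x, I a & forall y b, X y -> I b -> f x a <= f y b].

End Defs.

(* Main.v *)
Require Import Defs.
From HB Require Import structures.
From mathcomp Require Import all_boot all_order all_algebra.
From mathcomp Require Import all_classical all_reals all_analysis.
From mathcomp Require Import measurable_realfun ring lra.
Import Order.TTheory GRing.Theory Num.Theory.
Import numFieldNormedType.Exports.
Local Open Scope classical_set_scope.
Local Open Scope ring_scope.

(** Write e for the equal-weighted portfolio and r(q) = C rbase(q).  For large C
    the objective is governed by its term of order C^2, namely
    q r(q)^2 |x|^2, and among portfolios the Euclidean norm is smallest at e:
    on the simplex |x - e|^2 = |x|^2 - |e|^2.  So it is enough to bound the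
    excess |x_C|^2 - |e|^2 by a constant times 1/C.

    Let M > 0 be the maximum of q rbase(q)^2 over the window
    [q0 - eps, q0 + eps].
    - Lower bound ([hfun_ge], taken at the maximizer of q rbase(q)^2): for every
      x in the simplex and every real a, J(x, a) >= C^2 M |x|^2 - const, where the
      constant depends neither on x, nor on a, nor on C.  The uniformity in a is
      what makes the argument work for intervals I that change with C, since
      nothing bounds the minimizing a_C.  It comes from completing squares:
      S^2 - a gamma - gamma^2/4 is the variance of x'R plus
      (x'mu - a)^2 - gamma x'mu, and psi(y) >= - gamma y.
    - Upper bound ([Jfun_le]): at e and a fixed level b,
      J(e, b) <= C^2 M |e|^2 + O(C).

    The level b must belong to all the intervals at once.  The mean return of
    e under the mixture (1 - q0) PN + q0 PS0 does: this mixture lies in the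
    ambiguity set for every radius ([ambiguity_center]), because
    W2(PS0, PS0) = 0 ([W2_refl]).  Comparing the two bounds through the
    minimality of (x_C, a_C) gives C M (|x_C|^2 - |e|^2) <= D for C >= 1, and
    [cvg_equal_weights] concludes. *)

(** * Portfolios and their Euclidean norm *)

Section Simplex.
Set Implicit Arguments.
Unset Strict Implicit.
Context {R : realType} {d : nat}.
Implicit Types x u v : 'cV[R]_d.

Lemma dotpE u v : dotp u v = \sum_i u i ord0 * v i ord0.
Proof. by rewrite /dotp mxE; apply: eq_bigr => i _; rewrite mxE. Qed.

Lemma enorm_ge0 u : 0 <= enorm u. Proof. exact: sqrtr_ge0. Qed.

Lemma enorm_sqr u : enorm u ^+ 2 = \sum_i u i ord0 ^+ 2.
Proof.
have -> : \sum_i u i ord0 ^+ 2 = dotp u u.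
  by rewrite dotpE; apply: eq_bigr => i _; rewrite expr2.
rewrite /enorm sqr_sqrtr// dotpE sumr_ge0// => i _; exact: sqr_ge0.
Qed.

Lemma simplex_sum1 x : simplex x -> \sum_i x i ord0 = 1.
Proof.
by case=> _; rewrite dotpE => <-; apply: eq_bigr => i _; rewrite mxE mul1r.
Qed.

Lemma simplex_le1 x i : simplex x -> x i ord0 <= 1.
Proof.
move=> xs; rewrite -(simplex_sum1 xs) (bigD1 i)//= lerDl sumr_ge0// => j _.
by case: xs.
Qed.

(** In dimension 0 the weights cannot sum to 1. *)
Lemma simplex_dim_gt0 x : simplex x -> (0 < d)%N.
Proof.
move=> /simplex_sum1; case: (posnP d) => // d0.
rewrite big1 => [/esym/eqP|i _]; first by rewrite oner_eq0.
by have := ltn_ord i; rewrite {2}d0.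
Qed.

Lemma simplex_equal_weights :
  (0 < d)%N -> simplex (const_mx d%:R^-1 : 'cV[R]_d).
Proof.
move=> d0; split=> [i|]; first by rewrite mxE invr_ge0 ler0n.
rewrite dotpE; under eq_bigr do rewrite !mxE mul1r.
rewrite sumr_const card_ord -[RHS](@mulVf _ (d%:R : R)) ?pnatr_eq0 -?lt0n//.
by rewrite mulr_natr.
Qed.

(** The weights of x - e sum to 0, so x - e is orthogonal to e, and Pythagoras
    gives |x - e|^2 = |x|^2 - |e|^2; a single coordinate is bounded by the norm. *)
Lemma simplex_dist_equal_weights x i : simplex x ->
  (x i ord0 - d%:R^-1) ^+ 2
    <= enorm x ^+ 2 - enorm (const_mx d%:R^-1 : 'cV[R]_d) ^+ 2.
Proof.
move=> xs; have d0 := simplex_dim_gt0 xs.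
have -> : enorm x ^+ 2 - enorm (const_mx d%:R^-1 : 'cV[R]_d) ^+ 2
   = \sum_j (x j ord0 - d%:R^-1) ^+ 2.
  rewrite !enorm_sqr.
  have sqrE (c t : R) : (t - c) ^+ 2 = t ^+ 2 + ((- 2 * c) * t + c ^+ 2) by ring.
  under [RHS]eq_bigr do rewrite sqrE.
  rewrite big_split/= big_split/=; congr (_ + _).
  rewrite -mulr_sumr (simplex_sum1 xs) mulr1.
  under eq_bigr do rewrite mxE.
  rewrite !sumr_const card_ord -mulr_natr.
  have : (d%:R : R) != 0 by rewrite pnatr_eq0 -lt0n.
  by move=> ?; field.
rewrite (bigD1 i)//= lerDl sumr_ge0// => j _; exact: sqr_ge0.
Qed.

Lemma simplex_abs_dotp x v : simplex x -> `|dotp x v| <= \sum_i `|v i ord0|.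
Proof.
move=> xs; rewrite dotpE (le_trans (ler_norm_sum _ _ _))// ler_sum// => i _.
rewrite normrM ger0_norm; last by case: xs.
by rewrite ler_piMl// simplex_le1.
Qed.

(** Trades |x'v| for a quadratic bound free of x, integrable as soon as the
    second moment is finite: |t| <= 1 + t^2 in each coordinate, then average
    with the weights x. *)
Lemma simplex_abs_dotp_le x v : simplex x -> `|dotp x v| <= 1 + enorm v ^+ 2.
Proof.
move=> xs; rewrite dotpE (le_trans (ler_norm_sum _ _ _))//.
apply: (@le_trans _ _ (\sum_i x i ord0 * (1 + enorm v ^+ 2))).
  apply: ler_sum => i _.
  have x0 : 0 <= x i ord0 by case: xs.
  rewrite normrM ger0_norm// ler_wpM2l//.
  have : v i ord0 ^+ 2 <= enorm v ^+ 2.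
    rewrite enorm_sqr (bigD1 i)//= lerDl sumr_ge0// => j _; exact: sqr_ge0.
  rewrite -(real_normK (num_real (v i ord0))) => vE.
  by have := sqr_ge0 (`|v i ord0| - 2^-1); nra.
by rewrite -mulr_suml (simplex_sum1 xs) mul1r.
Qed.
End Simplex.

(** * Mixtures and the Wasserstein distance from a measure to itself *)

Lemma mixture_exists {disp : measure_display} {T : measurableType disp}
    {R : realType} (s t : {nonneg R}) (P Q : probability T R) :
    s%:num + t%:num = 1 ->
  exists mix : probability T R,
    forall A, mix A = (s%:num%:E * P A + t%:num%:E * Q A)%E.
Proof.
move=> st1; pose mix : {measure set T -> \bar R} :=
  measure_add (mscale s P) (mscale t Q).
have mscaleT (k : {nonneg R}) (P' : probability T R) :
    mscale k P' setT = k%:num%:E.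
  by rewrite -[RHS]mule1; congr (_ * _)%E; exact: probability_setT.
have mixT : mix setT = 1%E.
  transitivity (mscale s P setT + mscale t Q setT)%E; first exact: measure_addE.
  by rewrite -[RHS]/(1%:E) -st1 EFinD; congr (_ + _)%E; exact: mscaleT.
(* Normalizing a measure of total mass 1 changes nothing but its type. *)
exists (mnormalize mix P) => A.
rewrite /= /mnormalize mixT onee_eq0/= invr1 mule1; exact: measure_addE.
Qed.

Section Borel.
Set Implicit Arguments.
Unset Strict Implicit.
Context {R : realType} {d : nat}.
Implicit Types P Q : probability (borelRd R d) R.

Lemma measurable_coord (i : 'I_d) :
  measurable_fun setT (fun w : borelRd R d => (w : 'cV[R]_d) i ord0).
Proof.
apply: (measurability _ (RGenOpens.measurableE R)) => _ [_ [a [b ->] <-]].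
rewrite setTI; apply: sub_sigma_algebra.
have /continuousP := @coord_continuous R d 1 i ord0; apply.
exact: interval_open.
Qed.

Lemma measurable_enorm_sqr :
  measurable_fun setT (fun w : borelRd R d => enorm (w : 'cV[R]_d) ^+ 2).
Proof.
under eq_fun do rewrite enorm_sqr.
apply: measurable_sum => i; apply: measurable_funX; exact: measurable_coord.
Qed.

Lemma measurable_dotp (x : 'cV[R]_d) :
  measurable_fun setT (fun w : borelRd R d => dotp x (w : 'cV[R]_d)).
Proof.
under eq_fun do rewrite dotpE.
apply: measurable_sum => i; apply: measurable_funM => //.
exact: measurable_coord.
Qed.

Lemma measurable_dist_sqr : measurable_fun setT
  (fun z : (borelRd R d * borelRd R d)%type =>
     enorm ((z.1 : 'cV[R]_d) - z.2) ^+ 2).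
Proof.
under eq_fun do rewrite enorm_sqr.
apply: measurable_sum => i; apply: measurable_funX.
under eq_fun do rewrite mxE [X in _ + X]mxE.
apply: measurable_funB.
  exact: (measurableT_comp (measurable_coord i) measurable_fst).
exact: (measurableT_comp (measurable_coord i) measurable_snd).
Qed.

(** The law of (w, w) under P couples P with itself at cost 0. *)
Lemma W2_refl P : W2 P P = 0%E.
Proof.
have mD : measurable_fun setT (fun w : borelRd R d => (w, w)).
  exact: measurable_fun_pair.
pose D : {mfun borelRd R d >-> (borelRd R d * borelRd R d)%type} :=
  HB.pack (fun w : borelRd R d => (w, w)) (isMeasurableFun.Build _ _ _ _ _ mD).
pose pi : probability (borelRd R d * borelRd R d)%type R := distribution P D.
rewrite /W2; set E := [set _ | _ in _].
have E0 : E 0%E.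
  exists pi; first by move=> A mA; split.
  rewrite ge0_integral_distribution/=.
  - apply: integral0_eq => w _ /=.
    by rewrite subrr enorm_sqr big1// => i _; rewrite mxE expr0n.
  - apply/measurable_EFinP; exact: measurable_dist_sqr.
  - by move=> z; rewrite lee_fin sqr_ge0.
have -> : ereal_inf E = 0%E.
  apply/eqP; rewrite eq_le ereal_inf_lbound//=.
  apply/ereal_infP => _ [p _ <-]; apply: integral_ge0 => z _.
  by rewrite lee_fin sqr_ge0.
by rewrite poweR0r// invr_neq0.
Qed.

(** * Expectations bounded below uniformly in the portfolio and the level *)

(** Being a [fine] value, [Exp] is monotone only away from infinite integrals.
    Under a lower bound by an integrable function the integral of f cannot be
    -oo, and this much monotonicity survives. *)
Lemma Exp_ge P (f g : 'cV[R]_d -> R) :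
    measurable_fun setT (f : borelRd R d -> R) ->
    measurable_fun setT (g : borelRd R d -> R) ->
    (forall w, 0 <= g w) -> (forall w, - g w <= f w) ->
    (\int[P]_w (g w)%:E < +oo)%E ->
  - fine (\int[P]_w (g w)%:E)%E <= Exp P f.
Proof.
move=> mf mg g0 gf goo; rewrite /Exp unlock.
have G0 : (0 <= \int[P]_w (g w)%:E)%E.
  by apply: integral_ge0 => w _; rewrite lee_fin.
have Gfin : (\int[P]_w (g w)%:E)%E \is a fin_num by rewrite ge0_fin_numE.
(* If the integral of f is +oo, then [Exp P f] is 0, above the bound as well. *)
rewrite -fineN; case: ltgtP (@leey _ (\int[P]_w (f w)%:E)%E)
  => // [foo _|-> _]; last first.
  by rewrite fineN oppr_le0 fine_ge0.
have : (- (\int[P]_w (g w)%:E) <= \int[P]_w (f w)%:E)%E.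
  rewrite [leRHS]integralE -[leLHS]add0e leeD//.
    by apply: integral_ge0.
  rewrite leeN2 ge0_le_integral//=.
  - by apply: measurable_funeneg; exact/measurable_EFinP.
  - exact/measurable_EFinP.
  - move=> w _; rewrite funenegE -EFinN -EFin_max lee_fin ge_max g0 andbT.
    by have := gf w; lra.
move=> h; rewrite fine_le// ?fin_numN//.
by rewrite fin_real// foo andbT (lt_le_trans _ h)// ltNye_eq fin_numN Gfin.
Qed.

(** psi(y) >= - gamma y because the square is nonnegative, so the level a
    disappears from the bound; [simplex_abs_dotp_le] then removes x. *)
Lemma Exp_psi_ge P gamma : 0 < gamma -> finite_second_moment P ->
  exists2 K, 0 <= K &
  forall x a, simplex x -> - K <= Exp P (fun w => psi a gamma (dotp x w)).
Proof.
move=> gamma0 Pfin.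
pose g (w : 'cV[R]_d) := gamma * (1 + enorm w ^+ 2).
have g0 w : 0 <= g w by rewrite mulr_ge0 ?addr_ge0 ?sqr_ge0// ltW.
exists (fine (\int[P]_w (g w)%:E)%E).
  by rewrite fine_ge0// integral_ge0// => w _; rewrite lee_fin.
move=> x a xs; apply: Exp_ge => //.
- apply: measurable_funB.
    apply: measurable_funX; apply: measurable_funB => //.
    exact: measurable_dotp.
  by apply: measurable_funM => //; exact: measurable_dotp.
- apply: measurable_funM => //; apply: measurable_funD => //.
  exact: measurable_enorm_sqr.
- move=> w; rewrite /psi /g.
  have := simplex_abs_dotp_le w xs; rewrite ler_norml => /andP[_ h].
  by have := sqr_ge0 (dotp x w - a); nra.
- have -> : (\int[P]_w (g w)%:E = gamma%:E * (1 + \int[P]_w (enorm w ^+ 2)%:E))%E.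
    under eq_integral do rewrite /g EFinM EFinD.
    rewrite ge0_integralZl//=.
    + rewrite ge0_integralD//=.
      * congr (_ * (_ + _))%E.
        by rewrite integral_cst// mul1e; exact: probability_setT.
      * by move=> w _; rewrite lee_fin sqr_ge0.
      * apply/measurable_EFinP; exact: measurable_enorm_sqr.
    + apply: emeasurable_funD => //; apply/measurable_EFinP.
      exact: measurable_enorm_sqr.
    + by move=> w _; rewrite adde_ge0// lee_fin sqr_ge0.
    + by rewrite lee_fin ltW.
  apply: lte_mul_pinfty => //; first by rewrite lee_fin ltW.
  by apply: lte_add_pinfty => //; exact: ltry.
Qed.
End Borel.

(** * Two-sided bounds on the objective *)

Section Objective.
Set Implicit Arguments.
Unset Strict Implicit.
Context {R : realType} {d : nat}.
Implicit Types (PN PS : probability (borelRd R d) R) (x : 'cV[R]_d) (r : R -> R).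

Lemma Sgam_sqr PS gamma x a : 0 <= quad (cov PS) x ->
  Sgam PS gamma x a ^+ 2 =
    quad (cov PS) x + (dotp x (mean PS) - (2 * a + gamma) / 2) ^+ 2.
Proof. by move=> v0; rewrite sqr_sqrtr// addr_ge0// sqr_ge0. Qed.

Lemma posdef_quad_ge0 (A : 'M[R]_d) x : posdef A -> 0 <= quad A x.
Proof.
case=> _ A0; have [->|x0] := eqVneq x 0; last exact/ltW/A0.
by rewrite /quad dotpE sumr_ge0// => i _; rewrite mxE mul0r.
Qed.

(** Expanding the square (r|x| + S)^2, the cross term is nonnegative, and
    completing the square in a turns S^2 - a gamma - gamma^2/4 into
    v + (m - a)^2 - gamma m, with v the variance and m the mean of x'R under PS:
    only - gamma m can be negative. *)
Lemma hfun_ge PN PS gamma r q x a K L :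
    0 < gamma -> 0 <= q <= 1 -> 0 <= r q -> 0 <= quad (cov PS) x ->
    0 <= K -> - K <= Exp PN (fun w => psi a gamma (dotp x w)) ->
    `|dotp x (mean PS)| <= L ->
  q * r q ^+ 2 * enorm x ^+ 2 - (K + gamma * L) <= hfun PN PS gamma r q x a.
Proof.
move=> g0 /andP[q0 q1] rq0 v0 K0 EK mL; rewrite /hfun.
set E := Exp _ _ in EK *; set S := Sgam _ _ _ _.
have S0 : 0 <= S by exact: sqrtr_ge0.
have n0 := enorm_ge0 x.
have hE : - K <= (1 - q) * E by nra.
have hm : dotp x (mean PS) <= L by move: mL; rewrite ler_norml => /andP[].
have L0 : 0 <= L by exact: le_trans (normr_ge0 _) mL.
have hS : - (gamma * L) <= S ^+ 2 - a * gamma - gamma ^+ 2 / 4.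
  rewrite Sgam_sqr//; set m := dotp _ _ in hm *; set v := quad _ _ in v0 *.
  have -> : v + (m - (2 * a + gamma) / 2) ^+ 2 - a * gamma - gamma ^+ 2 / 4 =
    v + (m - a) ^+ 2 - gamma * m by field.
  by have := sqr_ge0 (m - a); nra.
set X := S ^+ 2 - _ - _ in hS.
have -> : (r q * enorm x + S) ^+ 2 - a * gamma - gamma ^+ 2 / 4 =
   r q ^+ 2 * enorm x ^+ 2 + 2 * (r q * enorm x * S) + X by rewrite /X; ring.
have rnS : 0 <= q * (r q * enorm x * S) by rewrite !mulr_ge0.
have qX : - (gamma * L) <= q * X.
  have gL : 0 <= gamma * L by rewrite mulr_ge0// ltW.
  by nra.
by lra.
Qed.

(** Keeps the factor q in front of r(q)^2, whose sharp bound M is the coefficient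
    to be matched with [hfun_ge], and estimates all other terms crudely: they
    are of lower order in the radius. *)
Lemma hfun_le PN PS gamma r q x a M B :
    0 <= q <= 1 -> 0 <= r q <= B -> q * r q ^+ 2 <= M ->
  hfun PN PS gamma r q x a <=
    M * enorm x ^+ 2 + 2 * (B * (enorm x * Sgam PS gamma x a)) +
    (`|Exp PN (fun w => psi a gamma (dotp x w))| +
     Sgam PS gamma x a ^+ 2 + `|a * gamma|).
Proof.
move=> /andP[q0 q1] /andP[rq0 rqB] qM; rewrite /hfun.
set E := Exp _ _; set S := Sgam _ _ _ _.
have S0 : 0 <= S by exact: sqrtr_ge0.
have n0 := enorm_ge0 x.
have hE : (1 - q) * E <= `|E|.
  by have := ler_norm E; have := normr_ge0 E; nra.
have ha : - q * (a * gamma) <= `|a * gamma|.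
  have := ler_norm (- (a * gamma)); rewrite normrN.
  by have := normr_ge0 (a * gamma); nra.
have hS : q * S ^+ 2 <= S ^+ 2 by rewrite ler_piMl// sqr_ge0.
have hg : 0 <= q * (gamma ^+ 2 / 4) by rewrite mulr_ge0// divr_ge0// sqr_ge0.
have hM : q * r q ^+ 2 * enorm x ^+ 2 <= M * enorm x ^+ 2.
  by rewrite ler_wpM2r// sqr_ge0.
have nS0 : 0 <= enorm x * S by rewrite mulr_ge0.
have hB : q * (r q * (enorm x * S)) <= B * (enorm x * S).
  rewrite (mulrA q) ler_wpM2r//; nra.
have -> : (1 - q) * E +
    q * ((r q * enorm x + S) ^+ 2 - a * gamma - gamma ^+ 2 / 4)
  = (1 - q) * E + - q * (a * gamma) + q * S ^+ 2 - q * (gamma ^+ 2 / 4)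
    + q * r q ^+ 2 * enorm x ^+ 2 + 2 * (q * (r q * (enorm x * S))) by ring.
by lra.
Qed.
End Objective.

Section Supremum.
Set Implicit Arguments.
Unset Strict Implicit.
Context {R : realType} {d : nat}.
Variables (PN PS : probability (borelRd R d) R).
Variables (gamma q0 eps M B : R) (r : R -> R).
Hypothesis window01 : forall q, q \in `[q0 - eps, q0 + eps] -> 0 <= q <= 1.
Hypothesis r_le : forall q, q \in `[q0 - eps, q0 + eps] -> 0 <= r q <= B.
Hypothesis qr2_le : forall q, q \in `[q0 - eps, q0 + eps] -> q * r q ^+ 2 <= M.

Lemma Jfun_le x a q : q \in `[q0 - eps, q0 + eps] ->
  Jfun PN PS gamma q0 eps r x a <=
    M * enorm x ^+ 2 + 2 * (B * (enorm x * Sgam PS gamma x a)) +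
    (`|Exp PN (fun w => psi a gamma (dotp x w))| +
     Sgam PS gamma x a ^+ 2 + `|a * gamma|).
Proof.
move=> qI; apply: ge_sup; first by exists (hfun PN PS gamma r q x a), q.
by move=> _ [p pI <-]; apply: hfun_le; [exact: window01|exact: r_le|exact: qr2_le].
Qed.

(** By [hfun_le] the set of values is bounded above, so its [sup] is an upper
    bound. *)
Lemma hfun_le_Jfun x a q : q \in `[q0 - eps, q0 + eps] ->
  hfun PN PS gamma r q x a <= Jfun PN PS gamma q0 eps r x a.
Proof.
move=> qI; apply: ub_le_sup; last by exists q.
eexists => _ [p pI <-].
by apply: hfun_le; [exact: window01|exact: r_le|exact: qr2_le].
Qed.
End Supremum.

(** * Comparison of the minimizer with the equal-weighted portfolio *)

(** P is chosen before r, so that one measure serves all radii: it is the mixture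
    of PN and PS with weight q0, as PS is at distance 0 from itself. *)
Lemma ambiguity_center {R : realType} {d : nat}
    (PN PS : probability (borelRd R d) R) (q0 eps : R) :
    0 <= q0 <= 1 -> 0 <= eps ->
  exists P, forall r, 0 <= r q0 -> ambiguity_set PN PS q0 eps r P.
Proof.
move=> /andP[q0_ge0 q0_le1] eps0.
have q1_ge0 : 0 <= 1 - q0 by rewrite subr_ge0.
have [mix mixE] := mixture_exists (s := NngNum q1_ge0) (t := NngNum q0_ge0)
  PN PS (subrK _ _).
exists mix => r rq0; exists q0, PS; split.
- by rewrite in_itv/= lerBlDr !lerDl eps0.
- by rewrite /W2_ball/= W2_refl lee_fin.
- by move=> A _; rewrite mixE.
Qed.

Lemma cvg_equal_weights {R : realType} {d : nat} (x : R -> 'cV[R]_d) (M D : R) :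
    0 < M -> (forall C, 1 <= C -> simplex (x C)) ->
    (forall C, 1 <= C -> M * (enorm (x C) ^+ 2 -
       enorm (const_mx d%:R^-1 : 'cV[R]_d) ^+ 2) * C <= D) ->
  x C @[C --> +oo] --> (const_mx d%:R^-1 : 'cV[R]_d).
Proof.
move=> M_gt0 xs excess; apply/cvg_ballP => t t0; near=> C; split=> // i j.
rewrite !ord1 mxE /ball/= distrC.
have C1 : 1 <= C by near: C; apply: nbhs_pinfty_ge; rewrite num_real.
(* Exactly the C for which the bound D / (M C) on the excess is below t^2. *)
have CD : D / (M * t ^+ 2) < C.
  by near: C; apply: nbhs_pinfty_gt; rewrite num_real.
have C0 : 0 < C by exact: lt_le_trans C1.
rewrite -(ltr_pXn2r (n := 2))// ?nnegrE ?normr_ge0 ?(ltW t0)//.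
rewrite real_normK ?num_real//.
apply: le_lt_trans (simplex_dist_equal_weights i (xs _ C1)) _.
move: CD; rewrite ltr_pdivrMr ?mulr_gt0 ?exprn_gt0// => CD.
rewrite -(ltr_pM2l M_gt0) -(ltr_pM2r C0) (le_lt_trans (excess _ C1))//.
by rewrite mulrC.
Unshelve. all: by end_near.
Qed.

Theorem theorem4 (R : realType) (d : nat) (gamma q0 eps : R)
    (PN PS0 : probability (borelRd R d) R) (rbase : R -> R)
    (I : R -> set R) (xstar : R -> 'cV[R]_d) (astar : R -> R)
    (gamma_gt0 : 0 < gamma)
    (PN_moment : finite_second_moment PN)
    (PS0_moment : finite_second_moment PS0)
    (PN_cov : posdef (cov PN)) (PS0_cov : posdef (cov PS0))
    (q0_range : 0 < q0 < 1)
    (eps_range : 0 < eps < Num.min q0 (1 - q0))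
    (rbase_ge0 : forall q, q \in `[0, 1] -> 0 <= rbase q)
    (rbase_cont : {within `[0, 1], continuous rbase})
    (rbase_neq0 : exists2 q, q \in `[q0 - eps, q0 + eps] & rbase q != 0)
    (I_interval : forall C, 0 < C -> is_interval (I C) /\ compact (I C))
    (I_contains : forall C, 0 < C -> forall x P, simplex x ->
       ambiguity_set PN PS0 q0 eps (fun q => C * rbase q) P ->
       I C (Exp P (fun w => dotp x w)))
    (star_min : forall C, 0 < C ->
       is_minimizer (Jfun PN PS0 gamma q0 eps (fun q => C * rbase q))
         simplex (I C) (xstar C) (astar C)) :
  xstar C @[C --> +oo] --> (const_mx d%:R^-1 : 'cV[R]_d).
Proof.
have /andP[q0_gt0 q0_lt1] := q0_range.
move: eps_range; rewrite lt_min => /andP[eps_gt0 /andP[eps_lt eps_lt']].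
have q0_in : q0 \in `[q0 - eps, q0 + eps].
  by rewrite in_itv/=; apply/andP; split; lra.
have window q : q \in `[q0 - eps, q0 + eps] -> 0 < q < 1.
  by rewrite in_itv/= => /andP[? ?]; apply/andP; split; lra.
have window01 q : q \in `[q0 - eps, q0 + eps] -> 0 <= q <= 1.
  by move=> /window/andP[? ?]; rewrite !ltW.
have sub : `[q0 - eps, q0 + eps]%classic `<=` `[0, 1]%classic.
  by move=> q /= /window01; rewrite in_itv.
have rbase_contW := continuous_subspaceW sub rbase_cont.
have le_window : q0 - eps <= q0 + eps by lra.
have r_ge0 q : q \in `[q0 - eps, q0 + eps] -> 0 <= rbase q.
  by move=> /window01 ?; apply: rbase_ge0; rewrite in_itv.
have [qB _ rB] := EVT_max le_window rbase_contW.
have qr2_cont :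
    {within `[q0 - eps, q0 + eps], continuous (fun q => q * rbase q ^+ 2)}.
  have id_cont : {within `[q0 - eps, q0 + eps], continuous (fun q : R => q)}.
    by apply: continuous_subspaceT => ?; exact: cvg_id.
  rewrite (_ : (fun q => _) = (fun q => q * (rbase q * rbase q))); last first.
    by apply/funext => q; rewrite expr2.
  move=> q; have rq_cont := rbase_contW q.
  exact: (continuousM (id_cont q) (continuousM rq_cont rq_cont)).
have [qM qM_in qr2M] := EVT_max le_window qr2_cont.
set B := rbase qB in rB; set M := qM * rbase qM ^+ 2 in qr2M.
have M_gt0 : 0 < M.
  have [q q_in rq0] := rbase_neq0; apply: lt_le_trans (qr2M q q_in).
  have /andP[q_gt0 _] := window _ q_in.
  by rewrite mulr_gt0// exprn_gt0// lt_def rq0 r_ge0.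
have [xs1 _ _] := star_min _ ltr01.
set e : 'cV[R]_d := const_mx _.
have es : simplex e by exact/simplex_equal_weights/(simplex_dim_gt0 xs1).
have q0_01 := window01 _ q0_in.
have [P0 P0_amb] := ambiguity_center PN PS0 q0_01 (ltW eps_gt0).
pose b := Exp P0 (fun w => dotp e w).
have Ib C : 0 < C -> I C b.
  move=> C0; apply: I_contains => //; apply: P0_amb.
  by apply: mulr_ge0; [exact: ltW|exact: r_ge0].
have [K K_ge0 EK] := Exp_psi_ge gamma_gt0 PN_moment.
pose L := \sum_i `|mean PS0 i ord0|.
(* The lower-order terms of both bounds, with C set to 1. *)
pose D := 2 * (B * (enorm e * Sgam PS0 gamma e b)) +
  (`|Exp PN (fun w => psi b gamma (dotp e w))| +
     Sgam PS0 gamma e b ^+ 2 + `|b * gamma|) + (K + gamma * L).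
have key C : 1 <= C -> M * (enorm (xstar C) ^+ 2 - enorm e ^+ 2) * C <= D.
  move=> C1; have C0 : 0 < C by exact: lt_le_trans C1.
  have [xs _ xmin] := star_min _ C0.
  pose r q := C * rbase q.
  have r_le q : q \in `[q0 - eps, q0 + eps] -> 0 <= r q <= C * B.
    move=> q_in; apply/andP; split.
      by apply: mulr_ge0; [exact: ltW|exact: r_ge0].
    by apply: ler_wpM2l; [exact: ltW|exact: rB].
  have qr2_le q : q \in `[q0 - eps, q0 + eps] -> q * r q ^+ 2 <= C ^+ 2 * M.
    move=> q_in; rewrite /r exprMn mulrCA ler_wpM2l ?sqr_ge0//; exact: qr2M.
  have upper := Jfun_le PN PS0 gamma window01 r_le qr2_le e b q0_in.
  have lower := hfun_le_Jfun PN PS0 gamma window01 r_le qr2_le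
    (xstar C) (astar C) qM_in.
  have /andP[rqM_ge0 _] := r_le _ qM_in.
  have hge := hfun_ge gamma_gt0 (window01 _ qM_in) rqM_ge0
    (posdef_quad_ge0 _ PS0_cov) K_ge0 (EK _ (astar C) xs)
    (simplex_abs_dotp (mean PS0) xs).
  have := le_trans hge (le_trans lower (le_trans (xmin _ _ es (Ib _ C0)) upper)).
  rewrite /r exprMn (mulrCA qM) -/M -/L => main.
  set N := enorm _ ^+ 2 - _.
  set E1 := `|_| in D main *; set S1 := Sgam _ _ _ _ in D main *.
  have S0 : 0 <= S1 by exact: sqrtr_ge0.
  have L_ge0 : 0 <= L by exact: sumr_ge0.
  (* The terms of D that do not grow with C are dominated by C times themselves,
     as they are nonnegative and C >= 1. *)
  rewrite -(ler_pM2l C0).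
  have rest : 0 <= (C - 1) * (E1 + S1 ^+ 2 + `|b * gamma| + (K + gamma * L)).
    apply: mulr_ge0; first by rewrite subr_ge0.
    have gL_ge0 : 0 <= gamma * L by apply: mulr_ge0 => //; exact: ltW.
    by have := sqr_ge0 S1; have := normr_ge0 (b * gamma); have := normr_ge0 (Exp PN
      (fun w => psi b gamma (dotp e w))); rewrite -/E1; lra.
  rewrite /D /N; move: main rest; lra.
apply: cvg_equal_weights M_gt0 _ key => C C1.
by have [] := star_min _ (lt_le_trans ltr01 C1).
Qed.
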